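(* Fix an integer $n>1$ and let $K$ be a number field of degree $n$. Let $$a(n) = \max_{0 \leq d \leq n-1} \left(\frac{d(n-1-d)}{n-1+d} + \frac{1}{n-1+d}\right),$$ where the maximum is over all integers $d$ with $0\le d\le n-1$. Then $$B^{\frac{1}{2}a(n)} \ll N_K(B) \quad \text{as } B\to\infty,$$ i.e. there are constants $c>0$ and $B_0$ (depending on $K$) such that $N_K(B)\ge c\,B^{a(n)/2}$ for all $B\ge B_0$.
   Context: Let $\mathcal{O}_K$ be the ring of integers of $K$. An order in $\mathcal{O}_K$ is a finite index subring of $\mathcal{O}_K$ containing the multiplicative identity. For a positive integer $k$, $F_K(k)=\#\{\mathcal{O}\subset\mathcal{O}_K : \mathcal{O} \text{ is an order of } \mathcal{O}_K \text{ and } |\operatorname{disc}(\mathcal{O})|=k\}$, where $\operatorname{disc}(\mathcal{O})=\operatorname{disc}(\mathcal{O}_K)[\mathcal{O}_K:\mathcal{O}]^2$. Finally $N_K(B)=\sum_{k\le B}F_K(k)$ is the number of orders in $\mathcal{O}_K$ whose discriminant has absolute value at most $B$. *)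

(* Defs.v *)
From HB Require Import structures.
From mathcomp Require Import all_boot all_order all_algebra all_field.
From mathcomp Require Import finmap.
From mathcomp Require Import mathcomp_extra boolp classical_sets cardinality.
From mathcomp Require Import reals exp.

Set Implicit Arguments.
Unset Strict Implicit.
Unset Printing Implicit Defensive.

Import Order.TTheory GRing.Theory Num.Theory.

Local Open Scope classical_set_scope.
Local Open Scope ring_scope.

Section Orders.
Variable K : fieldExtType rat.

Definition ring_of_integers : set K :=
  [set x | integralOver (intr : int -> K) x].

Definition cosets (A B : set K) : set (set K) :=
  [set C | exists2 x, A x & C = [set y | B (y - x)]].

(* [fset_set] sends an infinite set to the empty one, so the index is only
   meaningful together with [finite_set (cosets A B)]. *)
Definition add_index (A B : set K) : nat := #|` fset_set (cosets A B)|.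

Definition is_order (O : set K) : Prop :=
  [/\ O `<=` ring_of_integers,
      subring_closed (mem O)
    & finite_set (cosets ring_of_integers O)].

Definition field_trace (x : K) : rat :=
  \tr (passmx.mxof (vbasis {:K}) (vbasis {:K}) (amull x)).

Definition integral_basis (w : (\dim {:K}).-tuple K) : Prop :=
  (forall i, ring_of_integers (tnth w i)) /\
  (forall x, ring_of_integers x ->
     exists! c : {ffun 'I_(\dim {:K}) -> int}, x = \sum_i tnth w i *~ c i).

Definition basis_disc (w : (\dim {:K}).-tuple K) : rat :=
  \det (\matrix_(i, j) field_trace (tnth w i * tnth w j)).

(* The discriminant of the maximal order. It does not depend on the integral
   basis, and one always exists, so the default value 0 is never taken. *)
Definition field_disc : rat :=
  xget 0 [set basis_disc w | w in integral_basis].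

Definition order_disc (O : set K) : rat :=
  field_disc * (add_index ring_of_integers O)%:R ^+ 2.

Definition orders_of_disc (k : nat) : set (set K) :=
  [set O | is_order O /\ `|order_disc O| = k%:R].

(* F_K(k); the sets [orders_of_disc k] with k > 0 are finite. *)
Definition num_orders_of_disc (k : nat) : nat :=
  #|` fset_set (orders_of_disc k)|.

(* N_K(B) *)
Definition num_orders (R : realType) (B : R) : nat :=
  (\sum_(1 <= k < (Num.truncn B).+1) num_orders_of_disc k)%N.

End Orders.

(* The terms are positive when n > 1, so the seed 0 of the maximum is inert. *)
Definition order_exponent (R : realType) (n : nat) : R :=
  \big[Num.max/0]_(d < n)
    (d%:R * (n%:R - 1 - d%:R) / (n%:R - 1 + d%:R) + (n%:R - 1 + d%:R)^-1).

(* Main.v *)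
From HB Require Import structures.
Require Import Defs.
From mathcomp Require Import all_boot all_order all_algebra all_field.
From mathcomp Require Import finmap mathcomp_extra boolp classical_sets cardinality.
From mathcomp Require Import reals exp ring lra.

(* Write O for the ring of integers, with a Z-basis 1, u_1, ..., u_e,
   v_1, ..., v_d, so that e = n - 1 - d. For m > 0 and an e x d matrix A with
   entries modulo m, the lattice of all a + b.u + c.v with m | b and
   m^2 | c - b A lies between Z + m^2 O and Z + m O, hence is a ring. It has
   index m^(e + 2 d) = m^(n - 1 + d) and determines A, so there are at least
   m^(e d) orders of that index. Summing over all m up to
   M ~ B^(1 / (2 (n - 1 + d))) gives about M^(e d + 1) orders, and d is chosen
   to maximise the exponent. Using all integers m, not only primes, avoids the
   loss of a logarithm.

   The definitions count these orders only because the discriminant of the field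
   is a nonzero integer and the orders of a given index are finite in number;
   both follow from the existence of an integral basis, obtained by minimising
   the discriminant. *)

Set Implicit Arguments.
Unset Strict Implicit.

Import Order.TTheory GRing.Theory Num.Theory.
Import passmx.

Local Open Scope classical_set_scope.
Local Open Scope ring_scope.

(** * Traces and integral elements *)

(** The size is a successor because [horner_mx] needs a nonzero matrix ring; size 0 is split off
    wherever this is applied. *)
Lemma rep_horner (K : fieldExtType rat) (k : nat)
    (f : {linear K -> 'M[rat]_k.+1}) :
  f 1 = 1%:M -> {morph f : x y / x * y >-> x *m y} ->
  forall (x : K) (q : {poly rat}),
    horner_mx (f x) q = f (map_poly (in_alg K) q).[x].
Proof.
move=> f1 fM x; elim/poly_ind => [|q c IH].
  by rewrite !rmorph0 horner0 linear0.
rewrite rmorphD rmorphM /= horner_mx_C horner_mx_X IH.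
rewrite rmorphD rmorphM /= map_polyX map_polyC hornerMXaddC linearD /= fM.
by rewrite linearZ f1 /= scalemx1.
Qed.

Section MatrixRep.
Variables (K : fieldExtType rat) (k : nat) (phi : {linear K -> 'M[rat]_k}).
Hypothesis phi1 : phi 1 = 1%:M.
Hypothesis phiM : {morph phi : x y / x * y >-> x *m y}.

(** A monic integer polynomial that kills [x] kills its matrix, so it is divisible by the minimal
    polynomial and all eigenvalues are algebraic integers. The trace is their sum, and a rational
    algebraic integer is an integer. *)
Lemma int_mxtrace_rep (x : K) : ring_of_integers x -> \tr (phi x) \in Num.int.
Proof.
case=> p mon_p /eqP px0.
case: k phi phi1 phiM => [|n] f f1 fM;
  first by rewrite /mxtrace big_ord0 rpred0.
set P : {poly rat} := map_poly intr p.
have monP : P \is monic by rewrite monic_map.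
have PA : horner_mx (f x) P = 0.
  rewrite (rep_horner f1 fM) -map_poly_comp -[RHS](linear0 f) -px0;
    congr (f _.[x]).
  by apply: eq_map_poly => z; rewrite /= scaler_int.
set A := f x in PA *.
(* Over [algC] the characteristic polynomial splits, so that the trace can be read off its roots. *)
set B := map_mx (ratr : rat -> algC) A.
have [r Er] := closed_field_poly_normal (char_poly B).
have := monicP (char_poly_monic B); move=> lc; rewrite lc scale1r in Er.
have r_Aint z : z \in r -> z \in Aint.
  move=> zr; have : root (char_poly B) z by rewrite Er root_prod_XsubC.
  rewrite -eigenvalue_root_char eigenvalue_root_min => rz.
  apply: (@root_monic_Aint (map_poly ratr P)).
  - have /dvdpP[q ->] : mxminpoly B %| map_poly ratr P.
      by apply: mxminpoly_min; rewrite -map_horner_mx PA map_mx0.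
    by rewrite rootM rz orbT.
  - by rewrite monic_map.
  - apply/polyOverP => i; rewrite !coef_map /= Cint_rat; exact: intr_int.
rewrite -Cint_rat.
have -> : ratr (\tr A) = \tr B by rewrite /mxtrace rmorph_sum;
  apply: eq_bigr => i _; rewrite mxE.
apply: Cint_rat_Aint.
  by apply/CratP; exists (\tr A); rewrite /mxtrace rmorph_sum;
    apply: eq_bigr => i _; rewrite mxE.
rewrite -[\tr B]opprK -char_poly_trace // Er.
have sr : size r = n.+1.
  by apply: succn_inj; rewrite -(size_prod_XsubC _ id) -Er size_char_poly.
rewrite -sr coefPn_prod_XsubC ?sr // opprK big_seq.
exact: rpred_sum.
Qed.

Hypothesis phi_inj : injective phi.

(** Multiplying by all denominators of the matrix of [x] makes that matrix integral. By
    Cayley-Hamilton it is killed by its monic integer characteristic polynomial, and injectivity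
    carries the equation back to [K]. *)
Lemma rep_integral_multiple (x : K) :
  exists2 N : int, N != 0 & ring_of_integers (x *~ N).
Proof.
case: k phi phi1 phiM phi_inj => [|n] f f1 fM f_inj.
  (* In size 0, injectivity would force 1 = 0 in [K]. *)
  by have /eqP := oner_neq0 K; case; apply: f_inj; apply/matrixP; case.
pose N : int := \prod_(ij : 'I_n.+1 * 'I_n.+1) denq (f x ij.1 ij.2).
have N_neq0 : N != 0 by apply/prodf_neq0 => ij _; rewrite denq_eq0.
exists N => //.
have [A EA] : exists A : 'M[int]_n.+1, f (x *~ N) = map_mx intr A.
  exists (\matrix_(i, j) numq (N%:~R * f x i j)).
  apply/matrixP => i j; rewrite raddfMz /= -scaler_int !mxE numqK //.
  rewrite /N (bigD1 (i, j)) //= rmorphM /= mulrC mulrA -numqE.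
  by rewrite rpredM ?intr_int.
exists (char_poly A); first exact: char_poly_monic.
apply/eqP/f_inj; rewrite linear0.
have := Cayley_Hamilton (f (x *~ N)).
rewrite {2}EA -map_char_poly (rep_horner f1 fM) -map_poly_comp => E.
rewrite -[RHS]E; congr (f _.[_]).
by apply: eq_map_poly => z; rewrite /= scaler_int.
Qed.

End MatrixRep.

Section RegularRep.
Variable K : fieldExtType rat.

Definition regular_rep (x : K) := mxof (vbasis {:K}) (vbasis {:K}) (amull x).

Fact regular_rep_linear : linear regular_rep.
Proof. by move=> a x y; rewrite /regular_rep !linearP. Qed.
HB.instance Definition _ := GRing.isLinear.Build rat K _ _ regular_rep
  regular_rep_linear.

Lemma regular_rep1 : regular_rep 1 = 1%:M.
Proof. by rewrite /regular_rep amull1 mxof1 // (basis_free (vbasisP _)). Qed.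

Lemma regular_repM : {morph regular_rep : x y / x * y >-> x *m y}.
Proof.
(* Matrices acting on row vectors compose in the opposite order; commutativity of [K] restores
   it. *)
by move=> x y; rewrite /regular_rep mulrC amullM; apply: mxof_comp;
  exact: vbasisP.
Qed.

Lemma regular_rep_inj : injective regular_rep.
Proof.
by move=> x y /(can_inj (mxofK (vbasisP _) (vbasisP _)))/amull_inj.
Qed.

Lemma field_trace_rep (x : K) : field_trace x = \tr (regular_rep x).
Proof. by []. Qed.

Lemma field_trace_int (x : K) : ring_of_integers x -> field_trace x \in Num.int.
Proof. exact: int_mxtrace_rep regular_rep1 regular_repM _. Qed.

Lemma integral_multiple (x : K) :
  exists2 N : int, N != 0 & ring_of_integers (x *~ N).
Proof. exact: rep_integral_multiple regular_rep1 regular_repM regular_rep_inj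
  _. Qed.

Lemma field_trace1 : field_trace (1 : K) = (\dim {:K})%:R.
Proof. by rewrite field_trace_rep regular_rep1 mxtrace1. Qed.

Fact field_trace_linear : scalar (@field_trace K).
Proof. by move=> a x y; rewrite !field_trace_rep !linearP. Qed.
HB.instance Definition _ := GRing.isLinear.Build rat K _ _ (@field_trace K)
  field_trace_linear.

Lemma field_traceZ (a : rat) (x : K) : field_trace (a *: x) = a * field_trace x.
Proof. exact: linearZ. Qed.

Lemma field_trace_sum (I : finType) (F : I -> K) :
  field_trace (\sum_i F i) = \sum_i field_trace (F i).
Proof. exact: raddf_sum. Qed.

Lemma field_trace0 : field_trace (0 : K) = 0.
Proof. exact: linear0. Qed.

Lemma ring_of_integers1 : ring_of_integers (1 : K).
Proof. exact: integral1. Qed.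

Lemma ring_of_integersB (x y : K) :
  ring_of_integers x -> ring_of_integers y -> ring_of_integers (x - y).
Proof. by move=> xO yO; apply: (integral_sub xO yO). Qed.

Lemma ring_of_integersM (x y : K) :
  ring_of_integers x -> ring_of_integers y -> ring_of_integers (x * y).
Proof. by move=> xO yO; apply: (integral_mul xO yO). Qed.

Lemma ring_of_integers0 : ring_of_integers (0 : K).
Proof. by rewrite -(subrr 1); apply: ring_of_integersB;
  exact: ring_of_integers1. Qed.

Lemma ring_of_integersD (x y : K) :
  ring_of_integers x -> ring_of_integers y -> ring_of_integers (x + y).
Proof. by move=> xO yO; apply: (integral_add xO yO). Qed.

Lemma ring_of_integersN (x : K) : ring_of_integers x -> ring_of_integers (- x).
Proof. by move=> xO; apply: (integral_opp xO). Qed.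

Lemma ring_of_integers_int (z : int) : ring_of_integers (z%:~R : K).
Proof. exact: integral_id. Qed.

Lemma ring_of_integers_sum (I : finType) (P : pred I) (F : I -> K) :
  (forall i, P i -> ring_of_integers (F i)) ->
  ring_of_integers (\sum_(i | P i) F i).
Proof.
by move=> FO; elim/big_ind: _ => //;
  [exact: ring_of_integers0|exact: ring_of_integersD].
Qed.

Lemma ring_of_integersMz (x : K) (z : int) :
  ring_of_integers x -> ring_of_integers (x *~ z).
Proof.
by rewrite -mulrzr => xO; apply: ring_of_integersM xO (ring_of_integers_int z).
Qed.

(** The monic integer equation descends to [q] along the embedding of the rationals, which makes [q]
    a rational algebraic integer. *)
Lemma rat_ring_of_integers (q : rat) : ring_of_integers (q%:A : K) -> q \in
  Num.int.
Proof.
case=> p mon_p rp.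
have rp' : root (map_poly intr p) q.
  rewrite -(fmorph_root (in_alg K)) -map_poly_comp.
  rewrite (eq_map_poly (g := intr)) // => z; by rewrite /= scaler_int.
rewrite -Cint_rat; apply: Cint_rat_Aint; first exact: Crat_rat.
apply: (@root_monic_Aint (map_poly ratr (map_poly intr p))).
- by rewrite fmorph_root.
- by rewrite !monic_map.
- apply/polyOverP => i; rewrite !coef_map /= Cint_rat; exact: intr_int.
Qed.

End RegularRep.

(** * Integral bases *)

Section Discriminant.
Variable K : fieldExtType rat.
Local Notation n := (\dim {:K}).
Implicit Types (w : 'I_n -> K) (c : 'I_n -> rat).

(** The determinant is the discriminant of the family. Families are functions rather than tuples,
    which makes it easy to replace one member. *)
Definition gram w : 'M_n := \matrix_(i, j) field_trace (w i * w j).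

Lemma det_gram_int w : (forall i, ring_of_integers (w i)) ->
  \det (gram w) \in Num.int.
Proof.
move=> wO; rewrite -[gram w](_ : map_mx intr (map_mx numq (gram w)) = _).
  by rewrite det_map_mx intr_int.
apply/matrixP => i j; rewrite !mxE numqK // field_trace_int //.
exact: ring_of_integersM.
Qed.

(** Multiplying a linear relation by each [w j] and taking traces puts its coefficients in the left
    kernel of the Gram matrix. *)
Lemma gram_free w c : \det (gram w) != 0 -> \sum_i c i *: w i = 0 ->
  forall i, c i = 0.
Proof.
move=> dw cw i; pose v : 'rV_n := \row_j c j.
suff /rowP/(_ i) : v = 0 by rewrite !mxE.
apply/eqP; apply: contraNT dw => v0; apply/det0P; exists v => //.
apply/rowP => j; rewrite !mxE -[RHS](field_trace0 K) -(mul0r (w j)) -cw.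
rewrite mulr_suml field_trace_sum; apply: eq_bigr => k _.
by rewrite !mxE -scalerAl field_traceZ.
Qed.

Lemma gram_span w : \det (gram w) != 0 ->
  forall x, exists c, x = \sum_i c i *: w i.
Proof.
move=> dw x; pose t := [tuple w i | i < n].
have Et (i : 'I_n) : t`_i = w i by rewrite -tnth_nth tnth_mktuple.
have fr : free t.
  apply/freeP => c; rewrite (eq_bigr (fun i => c i *: w i));
    first exact: gram_free.
  by move=> i _; rewrite Et.
have bt : basis_of fullv t by rewrite basisEfree fr subvf size_tuple /=.
exists (fun i => coord t i x); rewrite {1}(coord_basis bt (memvf x)).
by apply: eq_bigr => i _; rewrite Et.
Qed.

(** Nondegeneracy of the trace form: a kernel vector would give a nonzero [x] with all traces of
    [x * y] zero, while the inverse of [x] as [y] yields the trace of 1, which is the degree. *)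
Lemma basis_det_gram w : basis_of fullv [tuple w i | i < n] -> \det (gram w) !=
  0.
Proof.
set t := [tuple _ | _ < _] => bt.
have Et (i : 'I_n) : t`_i = w i by rewrite -tnth_nth tnth_mktuple.
apply/negP => /det0P[v v0 vG].
pose x := \sum_i v 0 i *: w i.
have x0 : x != 0.
  apply: contraNneq v0 => x0; apply/eqP/rowP => i; rewrite mxE.
  have /freeP := basis_free bt; apply; rewrite -[RHS]x0.
  by apply: eq_bigr => k _; rewrite Et.
have tr0 y : field_trace (x * y) = 0.
  rewrite (coord_basis bt (memvf y)) mulr_sumr field_trace_sum big1 // => j _.
  rewrite Et -scalerAr; apply/eqP; rewrite field_traceZ /=.
  rewrite mulf_eq0; apply/orP; right; apply/eqP.
  move/rowP/(_ j): vG; rewrite !mxE => <-.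
  rewrite mulr_suml field_trace_sum; apply: eq_bigr => k _.
  by rewrite !mxE -scalerAl field_traceZ.
have := field_trace1 K; rewrite -(divff x0) tr0 => /esym/eqP.
by rewrite pnatr_eq0 gtn_eqF // adim_gt0.
Qed.

Lemma gram_change w (P : 'M[rat]_n) :
  gram (fun k => \sum_j P k j *: w j) = P *m gram w *m P^T.
Proof.
apply/matrixP => k l; rewrite mxE mulr_sumr field_trace_sum mxE.
apply: eq_bigr => j _; rewrite mulr_suml field_trace_sum !mxE mulr_suml.
apply: eq_bigr => h _.
by rewrite -scalerAr -scalerAl scalerA field_traceZ [gram w h j]mxE [RHS]mulrC
  mulrA.
Qed.

Lemma det_gram_replace w c (i : 'I_n) :
  \det (gram (fun k => if k == i then \sum_j c j *: w j else w k)) =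
  c i ^+ 2 * \det (gram w).
Proof.
pose P : 'M[rat]_n := \matrix_(k, j) if k == i then c j else (k == j)%:R.
have -> : (fun k => if k == i then \sum_j c j *: w j else w k) =
    (fun k => \sum_j P k j *: w j).
  apply/funext => k; case: ifP => ki.
    by apply: eq_bigr => j _; rewrite mxE ki.
  rewrite (bigD1 k) //= mxE ki eqxx scale1r big1 ?addr0 // => j jk.
  by rewrite mxE ki eq_sym (negPf jk) scale0r.
rewrite gram_change.
(* [P] is the identity outside row [i], and the cofactors along that row do not see it, so they are
   those of the identity. *)
have detP : \det P = c i.
  rewrite (expand_det_row P i) (bigD1 i) //= mxE eqxx.
  have cofP j : cofactor P i j = cofactor 1%:M i j.
    rewrite /cofactor; congr (_ * \det _); apply/matrixP => a b.
    by rewrite !mxE eq_sym (negPf (neq_lift _ _)).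
  have adj1 j : cofactor (1%:M : 'M[rat]_n) i j = (i == j)%:R.
    have := mul_mx_adj (1%:M : 'M[rat]_n); rewrite mul1mx det1.
    by move/matrixP/(_ j i); rewrite !mxE eq_sym.
  rewrite cofP adj1 eqxx mulr1 big1 ?addr0 // => j ji.
  by rewrite cofP adj1 eq_sym (negPf ji) mulr0.
by rewrite !det_mulmx det_tr detP expr2 mulrAC.
Qed.

End Discriminant.

Section IntegralBasis.
Variable K : fieldExtType rat.
Local Notation n := (\dim {:K}).
Implicit Types (w : 'I_n -> K).

(** A basis of a complement completes the line of 1. Having 1 in the basis is what later puts the
    integers inside every lattice. *)
Lemma basis_with_one (i0 : 'I_n) : val i0 = 0%N ->
  exists w, w i0 = 1 /\ basis_of fullv [tuple w i | i < n].
Proof.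
move=> i00.
have b1 : basis_of <[1 : K]> [:: 1].
  by rewrite basisEfree seq1_free oner_neq0 span_seq1 subvv dim_vline oner_neq0.
pose s := [:: 1] ++ vbasis (<[1 : K]>^C).
have bs : basis_of fullv s.
  rewrite -(addv_complf <[1 : K]>); apply: cat_basis b1 (vbasisP _).
  by apply/directv_addP; rewrite capv_compl.
have sz : size s = n by have /andP[/eqP <- /eqP ->] := bs.
exists (fun i => s`_i); split; first by rewrite i00.
suff -> : [tuple s`_i | i < n] = s :> seq K by [].
apply: (@eq_from_nth _ 0) => [|i]; rewrite size_tuple ?sz // => ilt.
exact: (nth_mktuple _ 0 (Ordinal ilt)).
Qed.

Definition unital_integral_family (i0 : 'I_n) w : Prop :=
  [/\ w i0 = 1, forall i, ring_of_integers (w i) & \det (gram w) != 0].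

(** Each basis vector other than 1 is scaled by a nonzero integer into the ring of integers; this
    multiplies the Gram determinant by a nonzero square. *)
Lemma exists_unital_integral_family (i0 : 'I_n) : val i0 = 0%N ->
  exists w, unital_integral_family i0 w.
Proof.
move=> i00; have [w [w1 bw]] := basis_with_one i00.
have [N NP] : {N : 'I_n -> int & forall i, N i != 0 /\ ring_of_integers (w i *~
  N i)}.
  apply: (@choice _ _ (fun i N => N != 0 /\ ring_of_integers (w i *~ N))) => i.
  by have [N N0 wN] := integral_multiple (w i); exists N.
exists (fun i => if i == i0 then 1 else w i *~ N i); split.
- by rewrite eqxx.
- by move=> i; case: eqP => _; [exact: ring_of_integers1|have [] := NP i].
pose a i : rat := if i == i0 then 1 else (N i)%:~R.
have a0 i : a i != 0.
  by rewrite /a; case: ifP => _; [exact: oner_neq0|rewrite intr_eq0;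
    have [] := NP i].
rewrite [gram _](_ : _ = diag_mx (\row_i a i) *m gram w *m diag_mx (\row_i a
  i)).
  rewrite !det_mulmx !det_diag !mulf_neq0 ?basis_det_gram //;
    by apply/prodf_neq0 => i _; rewrite mxE.
have aE i : (if i == i0 then 1 else w i *~ N i) = a i *: w i.
  by rewrite /a; case: eqP => [->|_]; rewrite ?w1 ?scale1r ?scaler_int.
apply/matrixP => i j; rewrite mul_mx_diag mul_diag_mx !mxE !aE.
by rewrite -scalerAr -scalerAl !field_traceZ mulrC.
Qed.

(* Replacing [w i] by [x - floor (c i) w i], where [c i] is a non-integral
   coordinate of an integral element [x], multiplies the discriminant by the
   square of the fractional part of [c i]; so a family with the least nonzero
   discriminant is an integral basis. *)
Lemma exists_unital_integral_basis (i0 : 'I_n) : val i0 = 0%N ->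
  exists w, unital_integral_family i0 w /\
    forall c : 'I_n -> rat, ring_of_integers (\sum_i c i *: w i) ->
      forall i, c i \in Num.int.
Proof.
move=> i00; have [w0 w0P] := exists_unital_integral_family i00.
(* The determinant is an integer, so its numerator carries its size and the descent runs over
   natural numbers. *)
have [m] := ubnP `|numq (\det (gram w0))|%N.
elim: m w0 w0P => // m IH w wP; rewrite ltnS => dm.
have [w1 wO dw] := wP.
have [[c [cO [i ci]]]|wmax] := pselect (exists c : 'I_n -> rat,
    ring_of_integers (\sum_i c i *: w i) /\ exists i, c i \notin Num.int);
      last first.
  exists w; split => // c cO i; apply: contrapT => /negP ci.
  by apply: wmax; exists c; split => //; exists i.
(* The vector 1 must survive the replacement. If only its coordinate were non-integral, subtracting
   the other terms would leave a rational number that is integral, hence an integer. *)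
have [j ji0 cj] : exists2 j, j != i0 & c j \notin Num.int.
  have [ii0|] := eqVneq i i0; last by exists i.
  apply: contrapT => nj; move/negP: ci; apply.
  apply: (@rat_ring_of_integers K).
  have -> : (c i)%:A = \sum_k c k *: w k - \sum_(k | k != i) c k *: w k.
    by rewrite [X in X - _](bigD1 i) //= addrK ii0 w1.
  apply: ring_of_integersB => //; apply: ring_of_integers_sum => k ki.
  have /numqK <- : c k \in Num.int.
    by apply: contrapT => /negP ck; apply: nj; exists k; rewrite // -ii0.
  by rewrite scaler_int; exact: ring_of_integersMz.
pose d k := if k == j then c k - (Num.floor (c j))%:~R else c k.
pose w' k := if k == j then \sum_l d l *: w l else w k.
have w'E : \sum_l d l *: w l = \sum_l c l *: w l - w j *~ Num.floor (c j).
  rewrite (bigD1 j) //= [in RHS](bigD1 j) //= /d eqxx scalerBl scaler_int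
    addrAC.
  by congr (_ + _ - _); apply: eq_bigr => k /negPf ->.
have dj0 : 0 < d j.
  rewrite /d eqxx subr_gt0 lt_neqAle floor_le andbT.
  by apply: contraNneq cj => <-; exact: intr_int.
have dj1 : d j < 1.
  by rewrite /d eqxx ltrBlDl; have := floorD1_gt (c j); rewrite intrD.
have w'P : unital_integral_family i0 w'.
  split; rewrite /w'.
  - by rewrite eq_sym (negPf ji0).
  - move=> k; case: eqP => // _; rewrite w'E.
    by apply: ring_of_integersB => //; exact: ring_of_integersMz.
  - by rewrite det_gram_replace mulf_neq0 // sqrf_eq0 gt_eqF.
apply: (IH w') => //; apply: leq_trans dm.
have [_ w'O _] := w'P.
rewrite -ltz_nat -(ltr_int rat) !abszE !intr_norm !numqK ?det_gram_int //.
rewrite det_gram_replace normrM gtr_pMl ?normr_gt0 //.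
by rewrite ger0_norm ?sqr_ge0 // expr_lt1 // ltW.
Qed.

End IntegralBasis.

(** * Indices and residues *)

Lemma card_fset_set_range (T : finType) (U : choiceType) (f : T -> U) :
  injective f -> #|` fset_set (range f)| = #|T|.
Proof.
move=> f_inj; have -> : fset_set (range f) = [fset f x | x in T]%fset.
  apply/fsetP => y; rewrite in_fset_set; last exact/finite_image/finite_finset.
  apply/idP/imfsetP => [|[x _ ->]]; rewrite inE /=; last by exists x.
  by case=> x _ <-; exists x.
by rewrite card_imfset // cardE enumT; congr size; rewrite -enumT;
  apply/eq_enum.
Qed.

(** Finiteness of [A] is essential, since [fset_set] turns an infinite set into the empty one. *)
Lemma leq_card_fset_set_range (T : finType) (U : choiceType) (f : T -> U)
    (A : set U) :
  finite_set A -> injective f -> (forall t, A (f t)) ->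
  (#|T| <= #|` fset_set A|)%N.
Proof.
move=> finA f_inj fA; rewrite -(card_fset_set_range f_inj).
apply: fsubset_leq_card; rewrite -fset_set_sub //.
- by move=> _ [t _ <-].
- exact/finite_image/finite_finset.
Qed.

Section Cosets.
Variables (K : fieldExtType rat) (G H : set K) (T : finType) (r : K -> T).
Hypothesis rG : forall x y, G x -> G y -> r x = r y <-> H (y - x).
Hypothesis HB : forall x y, H x -> H y -> H (x - y).
Hypothesis r_surj : forall t, exists2 x, G x & r x = t.

(** Choosing a representative for each value of [r] parametrises the cosets by [T]; both finiteness
    and the value of the index follow. *)
Lemma cosets_range : exists2 f : T -> set K, injective f & cosets G H = range f.
Proof.
have [s sP] : {s : T -> K & forall t, G (s t) /\ r (s t) = t}.
  apply: (@choice _ _ (fun t x => G x /\ r x = t)) => t.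
  by have [x] := r_surj t; exists x.
have [H0 HN HD] : [/\ H 0, (forall x, H x -> H (- x)) & (forall x y, H x -> H y
  -> H (x + y))].
  have [t0 t0P] : exists x, G x by have [x] := r_surj (r 0); exists x.
  have H0 : H 0 by rewrite -(subrr t0); apply/(rG t0P t0P).
  have HN x : H x -> H (- x) by rewrite -sub0r; exact: HB.
  by split=> // x y Hx /HN Hy; rewrite -[y]opprK; exact: HB.
have coset_eq x y : G x -> G y ->
    [set z | H (z - x)] = [set z | H (z - y)] <-> r x = r y.
  move=> Gx Gy; split=> [/seteqP[_ /(_ y)]|/rG-/(_ Gx Gy) Hyx].
    by rewrite /= subrr => /(_ H0) ?; apply/rG.
  apply/seteqP; split=> z /= Hz.
    by have := HB Hz Hyx; rewrite opprB addrA subrK.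
  by have := HD _ _ Hz Hyx; rewrite addrA subrK.
exists (fun t => [set z | H (z - s t)]).
  move=> t u; have [[Gt rt] [Gu ru]] := (sP t, sP u).
  by move/(coset_eq _ _ Gt Gu); rewrite rt ru.
apply/seteqP; split=> [C [x Gx ->]|_ [t _ <-]].
  exists (r x) => //; have [Gt rt] := sP (r x).
  exact/coset_eq.
by exists (s t) => //; have [] := sP t.
Qed.

Lemma finite_cosets : finite_set (cosets G H).
Proof.
have [f _ ->] := cosets_range; exact/finite_image/finite_finset.
Qed.

Lemma add_index_card : add_index G H = #|T|.
Proof.
by have [f finj E] := cosets_range; rewrite /add_index E card_fset_set_range.
Qed.
End Cosets.

Section Residues.
Variable q : nat.

(** The modulus is [q.+1], not [q], so that the ordinal type is inhabited. *)
Definition residue (z : int) : 'I_q.+1 := inord `|(z %% q.+1%:Z)%Z|.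

Lemma residueP (z t : int) :
  residue z = residue t <-> exists h, t - z = h * q.+1%:Z.
Proof.
have lt_mod u : (`|(u %% q.+1%:Z)%Z| < q.+1)%N.
  by rewrite -ltz_nat gez0_abs ?modz_ge0 // ltz_pmod.
split=> [/(congr1 val)|E].
  rewrite /= !inordK // => /(congr1 Posz); rewrite !gez0_abs ?modz_ge0 // => E.
  by apply/dvdzP; rewrite -eqz_mod_dvd; apply/eqP.
rewrite /residue; congr (inord `|_|%N); apply/esym/eqP.
by rewrite eqz_mod_dvd; apply/dvdzP.
Qed.

Lemma residueK (i : 'I_q.+1) : residue i%:Z = i.
Proof. by rewrite /residue modz_nat absz_nat modn_small // inord_val. Qed.

Lemma residue_mxP m n (A B : 'M[int]_(m, n)) :
  map_mx residue A = map_mx residue B <-> exists C, B - A = q.+1%:Z *: C.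
Proof.
split=> [E|[C E]].
  have hP i j : {h | B i j - A i j = h * q.+1%:Z}.
    by apply/cid/residueP; have /matrixP/(_ i j) := E; rewrite !mxE.
  exists (\matrix_(i, j) sval (hP i j)); apply/matrixP => i j.
  by rewrite !mxE mulrC; case: (hP i j).
apply/matrixP => i j; rewrite !mxE; apply/residueP; exists (C i j).
by have /matrixP/(_ i j) := E; rewrite !mxE mulrC.
Qed.

Lemma residue_mxK m n (A : 'M['I_q.+1]_(m, n)) :
  map_mx residue (map_mx (fun i : 'I_q.+1 => i%:Z) A) = A.
Proof. by apply/matrixP => i j; rewrite !mxE residueK. Qed.

End Residues.

(** * Orders in coordinates *)

Lemma order_subring (K : fieldExtType rat) (H : set K) : is_order H ->
  [/\ H 1, (forall x y, H x -> H y -> H (x - y)) &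
      forall x (z : int), H x -> H (x *~ z)].
Proof.
case=> _ [H1 HB' HM'] _.
have HB x y : H x -> H y -> H (x - y).
  by move=> Hx Hy; have := HB' x y; rewrite !inE; apply.
have H1' : H 1 by move: H1; rewrite inE.
have HM x y : H x -> H y -> H (x * y).
  by move=> Hx Hy; have := HM' x y; rewrite !inE; apply.
have H0 : H 0 by rewrite -(subrr 1); exact: HB.
have HN x : H x -> H (- x) by rewrite -sub0r; exact: HB.
have Hn (n : nat) : H n%:R.
  by elim: n => [//|n IH]; rewrite -addn1 natrD -[1%:R]opprK; apply: HB => //;
    exact: HN.
split=> // x z Hx; rewrite -mulrzr; apply: HM => //.
by case: z => n; rewrite ?NegzE ?mulrNz; [|apply: HN]; exact: Hn.
Qed.

(* Among the [q.+1] multiples [x *~ j], [j <= q], two are congruent modulo the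
   order. *)
Lemma order_fact_mul (K : fieldExtType rat) (H : set K) (q : nat) :
  is_order H -> add_index (@ring_of_integers K) H = q ->
  forall x, ring_of_integers x -> H (x *~ q`!).
Proof.
move=> oH Hq x xO; have [H1 HB HZ] := order_subring oH.
have [_ _ fin] := oH.
have H0 : H 0 by rewrite -(subrr 1); exact: HB.
pose C (j : 'I_q.+1) : set K := [set y | H (y - x *~ j)].
have [j [k jk Cjk]] : exists j : 'I_q.+1, exists2 k : 'I_q.+1, (j < k)%N & C j
  = C k.
  apply: contrapT => nC.
  suff /(leq_card_fset_set_range fin)/(_ _) : injective C.
    rewrite card_ord -/(add_index _ _) Hq ltnn => E; apply/notF/E => j.
    by exists (x *~ j) => //; exact: ring_of_integersMz.
  move=> j k Cjk; apply: val_inj; apply: contrapT => jk; apply: nC.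
  have [jltk|kltj|//] := ltngtP j k; first by exists j, k.
  by exists k, j.
have Hjk : H (x *~ (k - j)%N).
  have : C j (x *~ k) by rewrite Cjk /C /= subrr.
  by rewrite /C /= -mulrzBr subzn // ltnW.
(* The difference lies between 1 and [q], hence divides the factorial. *)
have /dvdnP[h ->] : (k - j %| q`!)%N.
  by apply: dvdn_fact; rewrite subn_gt0 jk /= (leq_trans (leq_subr _ _)) //
    -ltnS.
by rewrite mulnC PoszM mulrzA; exact: HZ.
Qed.

Lemma scalez_mx_inj (a : int) p q :
  a != 0 -> injective (fun A : 'M[int]_(p, q) => a *: A).
Proof.
move=> a0 A B /matrixP AB; apply/matrixP => i j.
by have := AB i j; rewrite !mxE; exact: mulfI.
Qed.

Section Coordinates.
Variables (K : fieldExtType rat) (e d : nat).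
Local Notation T := (int * 'rV[int]_e * 'rV[int]_d)%type.
Local Notation O := (@ring_of_integers K).
Variable comb : {additive T -> K}.
Hypothesis comb_inj : injective comb.
Hypothesis comb_range : range comb = O.
Hypothesis comb_int : forall a, comb (a, 0, 0) = a%:~R.

Lemma combO t : O (comb t). Proof. by rewrite -comb_range; exists t. Qed.

Definition coords (x : K) : T := xget 0 [set t | comb t = x].

Lemma combK : cancel comb coords.
Proof.
move=> t; apply: comb_inj.
by apply: (@xgetPex _ 0 [set u | comb u = comb t]); exists t.
Qed.

Lemma coordMz (a : int) (b : 'rV[int]_e) (c : 'rV[int]_d) (z : int) :
  (a, b, c) *~ z = (z * a, z *: b, z *: c).
Proof.
rewrite [LHS]surjective_pairing -[in z *: b](intz z) -[in z *: c](intz z).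
rewrite !scaler_int; congr (_, _); last exact: (raddfMz snd).
rewrite (raddfMz fst) /= [LHS]surjective_pairing; congr (_, _).
  by rewrite (raddfMz fst) /= mulrC -mulrzz.
exact: (raddfMz snd).
Qed.

(** An order of index [q] contains every multiple by [q!] of an integral element, so it is
    determined by its image among the finitely many coordinate residues modulo [q!]. *)
Lemma finite_orders_of_index (q : nat) :
  finite_set [set H : set K | is_order H /\ add_index O H = q].
Proof.
pose M := q`!.-1; have ME : M.+1 = q`! by rewrite prednK // fact_gt0.
pose r x := let t := coords x in
  (residue M t.1.1, map_mx (residue M) t.1.2, map_mx (residue M) t.2).
have rP x y : O x -> O y -> r x = r y -> exists2 z, O z & y - x = z *~ q`!.
  rewrite -comb_range => -[s _ <-] [t _ <-]; rewrite /r !combK.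
  case=> /residueP[a aE] /residue_mxP[b bE] /residue_mxP[c cE].
  exists (comb (a, b, c)); first by exists (a, b, c).
  rewrite -raddfMz -raddfB; congr (comb _).
  case: s t aE bE cE => [[s1 s2] s3] [[t1 t2] t3] /= aE bE cE.
  by rewrite -ME coordMz; congr (_, _, _); rewrite ?aE ?bE ?cE // mulrC.
pose g (S : {set 'I_M.+1 * 'rV['I_M.+1]_e * 'rV['I_M.+1]_d}) :=
  [set x | O x /\ r x \in S].
apply: (@sub_finite_set _ _ (range g)); last exact/finite_image/finite_finset.
move=> H [oH Hq]; exists (finset (fun f => `[< (r @` H) f >])) => //.
have [HO _ _] := oH; have [H1 HB HZ] := order_subring oH.
have HN x : H x -> H (- x) by move=> Hx; rewrite -(mulrN1z x); exact: HZ.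
apply/seteqP; split=> [x [xO]|x Hx]; rewrite /g /= inE; last first.
  by split; [exact: HO|apply/asboolP; exists x].
move=> /asboolP[y Hy ry].
have [z zO E] := rP _ _ (HO _ Hy) xO ry.
rewrite -[x](subrK y) E -[y]opprK; apply: HB; last exact: HN.
exact: order_fact_mul oH Hq _ zO.
Qed.

(** * The lattice attached to a modulus and a matrix *)

Section Lattice.
Variable k : nat.
Local Notation m := (k.+1%:Z).

(** The congruences m | b and m^2 | c - b A in parametric form: b = m b' and c = m b' A + m^2 c'. *)
Definition lattice_vec (A : 'M[int]_(e, d)) (t : T) : T :=
  (t.1.1, m *: t.1.2, m *: (t.1.2 *m A) + m ^+ 2 *: t.2).

Definition lattice A : set K := range (comb \o lattice_vec A).

Lemma lattice_vecB A s t :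
  lattice_vec A (s - t) = lattice_vec A s - lattice_vec A t.
Proof.
case: s t => [[s1 s2] s3] [[t1 t2] t3]; rewrite /lattice_vec /=.
congr (_, _, _); rewrite ?scalerBr //.
by rewrite mulmxBl !scalerBr addrACA -opprD.
Qed.

Lemma latticeB A x y : lattice A x -> lattice A y -> lattice A (x - y).
Proof.
by move=> [s _ <-] [t _ <-]; exists (s - t); rewrite //= lattice_vecB raddfB.
Qed.

Lemma lattice_sub A x : lattice A x -> O x.
Proof. by case=> t _ <-; exact: combO. Qed.

Lemma lattice_int A (a : int) : lattice A a%:~R.
Proof.
exists (a, 0, 0) => //=.
by rewrite /lattice_vec /= mul0mx !scaler0 addr0 comb_int.
Qed.

Lemma lattice_sqr A x : O x -> lattice A (x *~ (m ^+ 2)).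
Proof.
rewrite -comb_range => -[[[a b] c] _ <-].
(* The parameter [m *: b] contributes [m ^+ 2 *: (b *m A)] to the last block, which the shift of [c]
   cancels. *)
exists (m ^+ 2 * a, m *: b, c - b *m A) => //=; rewrite -raddfMz;
  congr (comb _).
rewrite coordMz /lattice_vec /=; congr (_, _, _); first by rewrite scalerA.
by rewrite -scalemxAl scalerA -expr2 scalerBr addrC subrK.
Qed.

Lemma latticeMz A x z : lattice A x -> lattice A (x *~ z).
Proof.
case=> t _ <-; exists (t *~ z) => //=; rewrite -raddfMz; congr (comb _).
case: t => [[a b] c]; rewrite coordMz /lattice_vec /= coordMz.
congr (_, _, _); first by rewrite scalerA mulrC -scalerA.
by rewrite -scalemxAl scalerDr !scalerA ![z * _]mulrC.
Qed.

Lemma lattice_int_part A x : lattice A x ->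
  exists a : int, exists2 y, O y & x = a%:~R + y *~ m.
Proof.
case=> [[[a b] c] _ <-]; exists a, (comb (0, b, b *m A + m *: c)).
  exact: combO.
rewrite -comb_int -raddfMz -raddfD; congr (comb _).
rewrite coordMz /lattice_vec /=.
congr (_, _, _); rewrite ?mulr0 ?addr0 ?add0r //.
by rewrite scalerDr scalerA expr2.
Qed.

(** For x = a + m x' and y = b + m y', one has x y = b x + a y - a b + m^2 x' y', and each term lies
    in the lattice. The sum is written with differences to suit [latticeB]. *)
Lemma latticeM A x y : lattice A x -> lattice A y -> lattice A (x * y).
Proof.
move=> Lx Ly; have [a [x' x'O xE]] := lattice_int_part Lx.
have [b [y' y'O yE]] := lattice_int_part Ly.
have -> : x * y = x *~ b - ((a * b)%:~R - y *~ a) - (- (x' * y')) *~ (m ^+ 2).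
  have zE (z : K) u : z *~ u = z * u%:~R by rewrite mulrzr.
  rewrite (zE x b) (zE y a) (zE (- _) (m ^+ 2)) xE yE (zE x' m) (zE y' m) expr2.
  by rewrite !intrM; ring.
apply: latticeB; last exact/lattice_sqr/ring_of_integersN/ring_of_integersM.
apply: latticeB; first exact: latticeMz.
by apply: latticeB; [exact: lattice_int|exact: latticeMz].
Qed.

(** This separates exactly the cosets of the lattice and takes every value, so the index is m^e
    (m^2)^d. The predecessor appears because [residue] takes the modulus minus one. *)
Definition lattice_residue (A : 'M[int]_(e, d)) (x : K) :=
  let t := coords x in
  (map_mx (residue k) t.1.2, map_mx (residue (k.+1 ^ 2).-1) (t.2 - t.1.2 *m A)).

Lemma lattice_residueP A x y : O x -> O y ->
  lattice_residue A x = lattice_residue A y <-> lattice A (y - x).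
Proof.
have mE : (k.+1 ^ 2).-1.+1%:Z = m ^+ 2.
  by rewrite prednK ?expn_gt0 // -natrX natz.
rewrite -comb_range => -[[[s1 s2] s3] _ <-] [[[t1 t2] t3] _ <-].
rewrite /lattice_residue !combK -raddfB;
  split=> [[]|[[[a b] c] _ /comb_inj[]]] /=.
  move=> /residue_mxP[b bE] /residue_mxP[c]; rewrite mE => cE.
  exists (t1 - s1, b, c) => //; congr (comb (_, _, _)) => //=.
  rewrite -cE scalemxAl -bE mulmxBl [t3 - _]addrC opprB addrA addrACA.
  by rewrite subrK -addrA addrA subrr add0r.
move=> _ bE' cE'.
have bE : m *: b = t2 - s2 by [].
have cE : m *: (b *m A) + m ^+ 2 *: c = t3 - s3 by [].
congr (_, _); apply/residue_mxP; first by exists b.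
exists c; rewrite mE opprB [X in _ + X]addrC addrACA [X in _ + X]addrC -[_ *m _
  - _ *m _]opprB.
by rewrite -mulmxBl -bE -cE -scalemxAl addrAC subrr add0r.
Qed.

Lemma lattice_residue_surj A t : exists2 x, O x & lattice_residue A x = t.
Proof.
case: t => b c.
pose b' := map_mx (fun i : 'I_k.+1 => i%:Z) b.
pose c' := map_mx (fun i : 'I_(k.+1 ^ 2).-1.+1 => i%:Z) c.
exists (comb (0, b', c' + b' *m A)); first exact: combO.
by rewrite /lattice_residue combK /= addrK !residue_mxK.
Qed.

Lemma lattice_order A : is_order (lattice A).
Proof.
split; first by move=> x; exact: lattice_sub.
- split; rewrite ?inE; first exact: (lattice_int A 1).
  + by move=> x y; rewrite !inE; exact: latticeB.
  + by move=> x y; rewrite !inE; exact: latticeM.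
- exact: finite_cosets (lattice_residueP A) (@latticeB A) (lattice_residue_surj
  A).
Qed.

Lemma lattice_index A : add_index O (lattice A) = (k.+1 ^ (e + d.*2))%N.
Proof.
rewrite (add_index_card (lattice_residueP A) (@latticeB A)
  (lattice_residue_surj A)).
rewrite card_prod !card_mx !card_ord prednK ?expn_gt0 //.
by rewrite !mul1n -expnM -expnD mul2n.
Qed.

(** The lattice of [A] contains the vector with blocks 0, m e_i and m times row i of [A]. If the
    lattice of [B] contains it too, the two rows multiplied by m agree modulo m^2, so they agree
    modulo m and are equal as residues. *)
Lemma lattice_inj :
  injective (fun A : 'M['I_k.+1]_(e, d) => lattice (map_mx (fun i : 'I_k.+1 =>
    i%:Z) A)).
Proof.
move=> A B; set A' := map_mx _ A; set B' := map_mx _ B => LAB.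
apply/row_matrixP => i.
rewrite -[row i A]residue_mxK -[row i B]residue_mxK (map_row _ A) (map_row _ B)
  -/A' -/B'.
have : lattice B' (comb (lattice_vec A' (0, delta_mx 0 i, 0))).
  by rewrite -LAB; exists (0, delta_mx 0 i, 0).
case=> [[[a b] c] _ /comb_inj[_ bE' cE']].
have bE : m *: b = m *: delta_mx 0 i by [].
have {bE} bE : b = delta_mx 0 i by exact: scalez_mx_inj bE.
have {cE'} cE : m *: (b *m B') + m ^+ 2 *: c = m *: (delta_mx 0 i *m A') + m ^+
  2 *: 0 by [].
apply/residue_mxP; exists (- c); rewrite !rowE; apply: (@scalez_mx_inj m) => //.
move: cE; rewrite bE scaler0 addr0 scalerBr => <-.
by rewrite opprD addrA subrr add0r scalerN scalerN scalerA expr2.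
Qed.

End Lattice.
End Coordinates.

(** * The field discriminant as a nonzero integer *)

Section FieldDiscriminant.
Variable K : fieldExtType rat.
Local Notation n := (\dim {:K}).
Local Notation O := (@ring_of_integers K).
Variables (i0 : 'I_n) (w : 'I_n -> K).
Hypothesis wP : unital_integral_family i0 w.
Hypothesis w_int : forall c : 'I_n -> rat, ring_of_integers (\sum_i c i *: w i)
  ->
  forall i, c i \in Num.int.

Lemma unital_coords x : O x -> exists c : 'I_n -> int, x = \sum_i w i *~ c i.
Proof.
move=> xO; have [_ _ dw] := wP; have [c xE] := gram_span dw x.
have c_int : forall i, c i \in Num.int by apply: w_int; rewrite -xE.
exists (fun i => numq (c i)); rewrite xE; apply: eq_bigr => i _.
by rewrite -scaler_int numqK.
Qed.

Lemma unital_free (c : 'I_n -> int) : \sum_i w i *~ c i = 0 -> forall i, c i =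
  0.
Proof.
have [_ _ dw] := wP => E i.
have /(_ i)/eqP : forall i, (c i)%:~R = 0 :> rat.
  apply: (gram_free dw); rewrite -[RHS]E; apply: eq_bigr => j _.
  by rewrite scaler_int.
by rewrite intr_eq0 => /eqP.
Qed.

Lemma unital_integral_basis : integral_basis [tuple w i | i < n].
Proof.
have [_ wO _] := wP.
split=> [i|x xO]; first by rewrite tnth_mktuple.
have [c cE] := unital_coords xO; exists [ffun i => c i]; split.
  by rewrite cE; apply: eq_bigr => i _; rewrite tnth_mktuple ffunE.
move=> c' xE; apply/ffunP => i; rewrite ffunE; apply/eqP; rewrite -subr_eq0;
  apply/eqP.
move: i; apply: unital_free; apply/eqP.
rewrite (eq_bigr (fun i => w i *~ c i - w i *~ c' i)) => [|i _];
  last exact: mulrzBr.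
rewrite sumrB subr_eq0 -cE xE; apply/eqP.
by apply: eq_bigr => i _; rewrite tnth_mktuple.
Qed.

(** [field_disc] comes from an unspecified integral basis. Expressing [w] in that basis multiplies
    the discriminant by a square and produces a nonzero value, so the discriminant itself is
    nonzero. *)
Lemma field_disc_int : exists2 D : nat, (0 < D)%N & `|field_disc K| = D%:R.
Proof.
have [t [tO tP] disct] : exists2 t : n.-tuple K, integral_basis t & basis_disc
  t = field_disc K.
  (* The family [w] is an integral basis, which rules out the default value of [xget]. *)
  have : [set basis_disc t | t in @integral_basis K] (field_disc K).
    by apply: xgetPex; exists (basis_disc [tuple w i | i < n]), [tuple w i | i
      < n];
      [exact: unital_integral_basis|].
  by case=> t tb tE; exists t.
have dE : field_disc K = \det (gram (tnth t)) by rewrite -disct.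
have d_int : field_disc K \in Num.int by rewrite dE; exact: det_gram_int.
have d0 : field_disc K != 0.
  have [_ wO dw] := wP.
  have cP i : {c : {ffun 'I_n -> int} | w i = \sum_j tnth t j *~ c j}.
    by apply: cid; have [c [cE _]] := tP _ (wO i); exists c.
  pose P : 'M[rat]_n := \matrix_(i, j) (sval (cP i) j)%:~R.
  have wE : w = fun i => \sum_j P i j *: tnth t j.
    apply/funext => i; rewrite {1}(svalP (cP i)); apply: eq_bigr => j _.
    by rewrite mxE scaler_int.
  by move: dw; rewrite {1}wE gram_change !det_mulmx -dE;
    apply: contraNneq => ->; rewrite mulr0 mul0r.
exists `|numq (field_disc K)|%N; first by rewrite absz_gt0 numq_eq0.
by rewrite -[in LHS](numqK d_int) -intr_norm -abszE.
Qed.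

End FieldDiscriminant.

(** * Coordinates from an integral basis *)

Section ExistsCoords.
Variables (K : fieldExtType rat) (e d : nat).
Hypothesis dimK : (1 + e + d)%N = \dim {:K}.
Local Notation T := (int * 'rV[int]_e * 'rV[int]_d)%type.

(** An integral basis that begins with 1 is cut into blocks of sizes 1, [e] and [d]. *)
Lemma exists_integral_coordinates : exists comb : {additive T -> K},
  [/\ injective comb, range comb = @ring_of_integers K &
      forall a, comb (a, 0, 0) = a%:~R].
Proof.
pose i0 : 'I_(\dim {:K}) := cast_ord dimK (lshift d (lshift e ord0)).
have [w [wP w_int]] := @exists_unital_integral_basis K i0 erefl.
pose coef (t : T) := row_mx (row_mx (const_mx t.1.1 : 'rV_1) t.1.2) t.2.
pose f (t : T) : K := \sum_i w i *~ coef t 0 (cast_ord (esym dimK) i).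
have coefB s t : coef (s - t) = coef s - coef t.
  rewrite /coef !opp_row_mx !add_row_mx; congr (row_mx (row_mx _ _) _).
  by apply/matrixP => i j; rewrite !mxE.
have f_sub : zmod_morphism f.
  move=> s t; rewrite /f -sumrB; apply: eq_bigr => i _.
  by rewrite coefB !mxE mulrzBr.
pose comb : {additive T -> K} := HB.pack f (GRing.isZmodMorphism.Build _ _ f
  f_sub).
have combE t : comb t = \sum_i w i *~ coef t 0 (cast_ord (esym dimK) i) by [].
exists comb; split.
- apply: raddf_inj => t; rewrite combE => /(unital_free wP) t0.
  have {}t0 : coef t = 0.
    apply/rowP => i; rewrite [RHS]mxE -(t0 (cast_ord dimK i)).
    by rewrite cast_ord_comp cast_ord_id.
  case: t t0 => [[a b] c]; rewrite /coef /= -row_mx0 => /eq_row_mx[+ ->].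
  by rewrite -row_mx0 => /eq_row_mx[/matrixP/(_ 0 0)+ ->]; rewrite !mxE => ->.
- have [_ wO _] := wP; apply/seteqP; split=> [_ [t _ <-]|x xO].
    by rewrite combE; apply: ring_of_integers_sum => i _;
      exact: ring_of_integersMz.
  have [c ->] := unital_coords wP w_int xO.
  pose v : 'rV[int]_(1 + e + d) := \row_i c (cast_ord dimK i).
  exists (lsubmx (lsubmx v) 0 0, rsubmx (lsubmx v), rsubmx v) => //.
  rewrite combE; apply: eq_bigr => i _; congr (_ *~ _).
  rewrite /coef /= (_ : const_mx _ = lsubmx (lsubmx v)) ?hsubmxK.
    by rewrite mxE cast_ord_comp cast_ord_id.
  by apply/matrixP => a b; rewrite mxE !ord1.
- move=> a; have [w1 _ _] := wP; rewrite combE (bigD1 i0) //= w1 big1 ?addr0.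
    by rewrite /coef cast_ord_comp cast_ord_id !row_mxEl mxE.
  move=> i ii0; rewrite (_ : coef _ _ _ = 0) ?mulr0z //.
  move: ii0; rewrite -(inj_eq (cast_ord_inj (eq_n := esym dimK))).
  rewrite /i0 cast_ord_comp cast_ord_id; move: (cast_ord _ i) => i'.
  case: (split_ordP i') => j -> ji.
    rewrite /coef row_mxEl; case: (split_ordP j) ji => k -> ji.
      by rewrite !ord1 eqxx in ji.
    by rewrite row_mxEr mxE.
  by rewrite /coef row_mxEr mxE.
Qed.

End ExistsCoords.

Lemma field_disc_nat (K : fieldExtType rat) :
  exists2 D : nat, (0 < D)%N & `|field_disc K| = D%:R.
Proof.
have K0 : (0 < \dim {:K})%N := adim_gt0 {:K}%AS.
have [w [wP w_int]] := @exists_unital_integral_basis K (Ordinal K0) erefl.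
exact: field_disc_int wP w_int.
Qed.

(** * Counting orders by discriminant *)

Section Counting.
Variables (K : fieldExtType rat) (e d D : nat).
Hypothesis dimK : (1 + e + d)%N = \dim {:K}.
Hypothesis D_gt0 : (0 < D)%N.
Hypothesis discK : `|field_disc K| = D%:R.

Lemma order_disc_norm (H : set K) :
  `|order_disc H| = (D * add_index (@ring_of_integers K) H ^ 2)%:R.
Proof.
by rewrite /order_disc normrM discK ger0_norm ?sqr_ge0 // natrM natrX.
Qed.

(** The matrices modulo [m] give distinct orders of the required index. Finiteness of the orders of
    that index also matters: an infinite set would be counted as 0. *)
Lemma num_orders_of_disc_ge (m : nat) : (0 < m)%N ->
  (m ^ (e * d) <= num_orders_of_disc K (D * (m ^ (e + d.*2)) ^ 2))%N.
Proof.
case: m => // k _; have [comb [comb_inj comb_range comb_int]] :=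
  exists_integral_coordinates dimK.
have <- : #|{: 'M['I_k.+1]_(e, d)}| = (k.+1 ^ (e * d))%N by rewrite card_mx
  card_ord.
apply: (leq_card_fset_set_range _ (lattice_inj comb_inj (k := k))).
  apply: sub_finite_set (finite_orders_of_index comb_inj comb_range (k.+1 ^ (e
    + d.*2))).
  move=> H [oH]; rewrite order_disc_norm => /eqP;
    rewrite eqr_nat eqn_pmul2l // eqn_exp2r //.
  by move/eqP.
move=> A; split; first exact: lattice_order.
by rewrite order_disc_norm lattice_index.
Qed.

(** Different [m] give different discriminants, as the exponent of [m] is positive. The bounds for
    the individual [m] therefore add up inside the sum that defines [num_orders]. *)
Lemma num_orders_ge (R : realType) (B : R) (M : nat) : (0 < e + d)%N ->
  (D * (M ^ (e + d.*2)) ^ 2)%:R <= B ->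
  (\sum_(1 <= m < M.+1) m ^ (e * d) <= num_orders K B)%N.
Proof.
move=> ed0 MB; pose g m := (D * (m ^ (e + d.*2)) ^ 2)%N.
have q0 : (0 < e + d.*2)%N.
  by apply: leq_trans ed0 _; rewrite leq_add2l -addnn leq_addl.
have g_inj : injective g.
  move=> m p /eqP; rewrite /g eqn_pmul2l // !eqn_exp2r //.
  by move/eqP.
apply: (@leq_trans (\sum_(1 <= m < M.+1) num_orders_of_disc K (g m))).
  rewrite !big_nat; apply: leq_sum => m /andP[m0 _];
    exact: num_orders_of_disc_ge.
rewrite -(big_map g xpredT (num_orders_of_disc K)) /num_orders.
apply: (uniq_sub_le_big (le := leq)) => //.
- by move=> x y; exact: leq_addr.
- by rewrite map_inj_uniq // iota_uniq.
- exact: iota_uniq.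
move=> _ /mapP[m mM ->]; move: mM; rewrite !mem_index_iota => /andP[m0 mM].
rewrite /g muln_gt0 D_gt0 !expn_gt0 m0 /= ltnS.
rewrite truncn_ge_nat; last exact: le_trans MB.
by apply: le_trans MB; rewrite ler_nat leq_mul2l !leq_exp2r // -ltnS mM orbT.
Qed.

End Counting.

(** * Sums of powers, the exponent and the final estimate *)

Lemma expn_succ_le (M s : nat) : (M.+1 ^ s.+1 <= M ^ s.+1 + s.+1 * M.+1 ^ s)%N.
Proof.
elim: s => [|s IH]; first by rewrite !expn1 expn0 muln1 addn1.
rewrite expnS (leq_trans (leq_mul (leqnn M.+1) IH)) // mulnDr.
rewrite [X in (X + _ <= _)%N]mulSn -expnS mulnCA -expnS [(s.+2 * _)%N]mulSn.
by rewrite [X in (X + _ <= _)%N]addnC -addnA leq_add2l leq_add2r leq_exp2r.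
Qed.

(** The discrete counterpart of comparing a sum of powers with its integral, by telescoping the
    previous bound. *)
Lemma expn_succ_le_sum (M s : nat) :
  (M ^ s.+1 <= s.+1 * \sum_(1 <= m < M.+1) m ^ s)%N.
Proof.
elim: M => [|M IH]; first by rewrite exp0n.
rewrite big_nat_recr //= mulnDr (leq_trans (expn_succ_le _ _)) //.
by rewrite leq_add2r.
Qed.

(** The terms are nonnegative, so the maximum with seed 0 is attained at some [d]. With e = n - 1 -
    d the common denominator n - 1 + d is e + 2 d. *)
Lemma order_exponentE (R : realType) (n : nat) : (1 < n)%N ->
  exists e d : nat, [/\ (1 + e + d)%N = n, (0 < e + d)%N &
    order_exponent R n = (e * d).+1%:R / (e + d.*2)%:R].
Proof.
(* From here on [n] is the degree minus one. *)
case: n => // n n1; rewrite /order_exponent.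
have nE (d : 'I_n.+1) : n.+1%:R - 1 - d%:R = (n - d)%:R :> R.
  by rewrite -natr1 addrK natrB // -ltnS.
have nD (d : 'I_n.+1) : n.+1%:R - 1 + d%:R = (n + d)%:R :> R.
  by rewrite -natr1 addrK natrD.
have [|i _|d _ ->] := @eq_bigmax _ _ _ 0 (ord0 : 'I_n.+1) xpredT (fun d => 
  (d%:R * (n.+1%:R - 1 - d%:R) / (n.+1%:R - 1 + d%:R) + (n.+1%:R - 1 + d%:R)^-1
    : R)) => //.
  by rewrite nE nD addr_ge0 ?invr_ge0 ?divr_ge0 ?mulr_ge0.
have dn : (d <= n)%N by rewrite -ltnS.
exists (n - d)%N, d; split; first by rewrite -addnA subnK.
  by rewrite subnK.
rewrite nE nD -addnn addnA subnK // -natrM mulnC -[X in _ + X]mul1r -mulrDl.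
by rewrite natr1.
Qed.

Theorem theorem6p2 (R : realType) (n : nat) (K : fieldExtType rat)
    (hn : (1 < n)%N) (hK : \dim {:K} = n) :
  exists2 c : R, 0 < c &
    exists B0 : R, forall B : R, B0 <= B ->
      c * B `^ (order_exponent R n / 2) <= (num_orders K B)%:R.
Proof.
have [D D0 DE] := field_disc_nat K.
have [e [d [edn ed0 ->]]] := order_exponentE R hn.
set s := (e * d)%N; set q := (e + d.*2)%N; set a : R := _ / 2.
have q0 : (0 < q)%N by apply: leq_trans ed0 _;
  rewrite leq_add2l -addnn leq_addl.
have DR0 : 0 < D%:R :> R by rewrite ltr0n.
(* The three factors pay for passing from [B] to [B / D], for rounding [Y] down to an integer, and
   for the sum of powers. *)
pose c : R := D%:R^-1 `^ a / 2 ^+ s.+1 / s.+1%:R.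
exists c; first by rewrite !divr_gt0 ?exprn_gt0 // powR_gt0 // invr_gt0.
(* This threshold is the value of [B] at which [Y] below equals 2. *)
exists (D%:R * 2 ^+ q.*2) => B hB.
pose t : R := q.*2%:R^-1.
have t0 : 0 < t by rewrite invr_gt0 ltr0n double_gt0.
have B0 : 0 < B by apply: lt_le_trans hB; rewrite mulr_gt0 // exprn_gt0.
(* [Y] is the real solution of D Y^(2 q) = B; its integer part is the largest admissible [m]. *)
pose Y := (B / D%:R) `^ t.
have BD0 : 0 <= B / D%:R by rewrite ltW // divr_gt0.
have powt (x : R) : 0 <= x -> (x ^+ q.*2) `^ t = x.
  by move=> x0; rewrite -powR_mulrn // -powRrM divff ?powRr1 // pnatr_eq0 -lt0n
    double_gt0.
have Y2 : 2 <= Y.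
  rewrite -[leLHS]powt //; apply: ge0_ler_powR;
    rewrite ?nnegrE ?exprn_ge0 ?(ltW t0) //.
  by rewrite ler_pdivlMr // mulrC.
have Yq : Y ^+ q.*2 = B / D%:R.
  by rewrite -powR_mulrn ?powR_ge0 // -powRrM mulVf ?powRr1 // pnatr_eq0 -lt0n
    double_gt0.
have Ys : Y ^+ s.+1 = B `^ a * D%:R^-1 `^ a.
  rewrite -powRM ?invr_ge0 ?ltW // -powR_mulrn ?powR_ge0 // -powRrM;
    congr (_ `^ _).
  by rewrite /a /t -mul2n natrM invfM mulrC mulrA mulrAC.
pose M := Num.truncn Y.
have Y0 : 0 <= Y by rewrite powR_ge0.
have MY : M%:R <= Y by rewrite truncn_le.
(* Since [Y] is at least 2, rounding down loses at most half of it. *)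
have YM : Y / 2 <= M%:R.
  have : Y < M.+1%:R by exact: truncnS_gt.
  rewrite -addn1 natrD; lra.
have MB : (D * (M ^ q) ^ 2)%:R <= B.
  rewrite -expnM muln2 natrM natrX -ler_pdivlMl // mulrC -Yq.
  by rewrite lerXn2r ?nnegrE.
have dimK : (1 + e + d)%N = \dim {:K} by rewrite hK.
have /(leq_mul (leqnn s.+1)) := num_orders_ge dimK D0 DE ed0 MB.
move=> /(leq_trans (expn_succ_le_sum M s));
  rewrite -(ler_nat R) natrM natrX mulrC => NM.
rewrite -ler_pdivrMr ?ltr0n // in NM; apply: le_trans NM.
have -> : c * B `^ a = (Y / 2) ^+ s.+1 / s.+1%:R.
  by rewrite exprMn exprVn Ys /c; ring.
rewrite ler_wpM2r ?invr_ge0 // lerXn2r ?nnegrE //.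
by rewrite divr_ge0.
Qed.
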